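(* Let $n\ge1$ and let $f:\{-1,1\}^n\to\mathbb{R}$ be a pseudo-Boolean function of width $\rho\ge 1$. Then for each positive integer $r$, $$\|f\|_{2r}\le \left[(2r)!\,\rho^{\,r-1}\right]^{\frac{1}{2r}}\,\|f\|_2 .$$
   Context: $[n]=\{1,\dots,n\}$ and $\chi_I(x)=\prod_{i\in I}x_i$ (with $\chi_\emptyset\equiv 1$). Every $f:\{-1,1\}^n\to\mathbb{R}$ can be written uniquely as $f(x)=\sum_{I\in\mathcal{F}}\hat f(I)\chi_I(x)$ with $\mathcal{F}$ a family of subsets of $[n]$ and each coefficient $\hat f(I)$ a nonzero real. For $i\in[n]$, $\rho_i$ is the number of sets $I\in\mathcal{F}$ with $i\in I$, and the width of $f$ is $\rho=\max\{\rho_i: i\in[n]\}$. Let $\mathbf{x}=(\mathbf{x}_1,\dots,\mathbf{x}_n)$ where the $\mathbf{x}_i$ are independent random variables, each uniform on $\{-1,1\}$. For $p\ge1$, $\|f\|_p=(\mathbb{E}[|f(\mathbf{x})|^p])^{1/p}$. *)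

(* Defs.v *)
From mathcomp Require Import all_boot all_order all_algebra.
From mathcomp Require Import reals exp.

Set Implicit Arguments.
Unset Strict Implicit.
Unset Printing Implicit Defensive.

Import Order.TTheory GRing.Theory Num.Theory.

Local Open Scope ring_scope.

(* The discrete cube {-1,1}^n: a bit b stands for the sign (-1)^b. *)
Definition cube (n : nat) := {ffun 'I_n -> bool}.

Definition coordinate (R : realType) (n : nat) (x : cube n) (i : 'I_n) : R :=
  (-1) ^+ (x i).

Definition chi (R : realType) (n : nat) (I : {set 'I_n}) (x : cube n) : R :=
  \prod_(i in I) coordinate R x i.

Definition fourier_expansion (R : realType) (n : nat) (f : cube n -> R)
    (F : {set {set 'I_n}}) (fhat : {set 'I_n} -> R) : Prop :=
  (forall I, I \in F -> fhat I != 0) /\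
  (forall x, f x = \sum_(I in F) fhat I * chi R I x).

Definition family_rho (n : nat) (F : {set {set 'I_n}}) (i : 'I_n) : nat :=
  #|[set I in F | i \in I]|.

Definition family_width (n : nat) (F : {set {set 'I_n}}) : nat :=
  \max_(i < n) family_rho F i.

(* The family F exists and is determined by f: see fourier_expansion_exists
   and fourier_expansion_unique below. *)
Definition has_width (R : realType) (n : nat) (f : cube n -> R) (rho : nat) :
    Prop :=
  exists (F : {set {set 'I_n}}) (fhat : {set 'I_n} -> R),
    fourier_expansion f F fhat /\ family_width F = rho.

(* The coordinates being independent and uniform on {-1,1}, the point x has
   probability \prod_i 1/2. *)
Definition expectation (R : realType) (n : nat) (g : cube n -> R) : R :=
  \sum_(x : cube n) (\prod_(i < n) 2^-1) * g x.

Definition Lp_norm (R : realType) (n : nat) (p : R) (f : cube n -> R) : R :=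
  (expectation (fun x => `|f x| `^ p)) `^ (p^-1).

Lemma chi_ifE (R : realType) (n : nat) (I : {set 'I_n}) (x : cube n) :
  chi R I x = \prod_(i < n) (if i \in I then coordinate R x i else 1).
Proof. by rewrite /chi big_mkcond. Qed.

Lemma chi_orthogonal (R : realType) (n : nat) (I J : {set 'I_n}) :
  \sum_(x : cube n) chi R I x * chi R J x = (2 ^ n)%:R * (I == J)%:R.
Proof.
pose G i (b : bool) : R :=
  (if i \in I then (-1) ^+ b else 1) * (if i \in J then (-1) ^+ b else 1).
transitivity (\sum_(x : cube n) \prod_(i < n) G i (x i)).
  by apply: eq_bigr => x _; rewrite !chi_ifE -big_split.
rewrite -(bigA_distr_bigA G).
have [eqIJ|neqIJ] := eqVneq I J.
  rewrite mulr1 -[n in (2 ^ n)%N]card_ord natrX -prodr_const.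
  apply: eq_bigr => i _; rewrite big_bool /G -eqIJ.
  by case: (i \in I); rewrite ?expr1 ?expr0 ?mulrNN ?mulr1.
rewrite mulr0; have [i neqi] : exists i, (i \in I) != (i \in J).
  apply/existsP; apply: contraNT neqIJ => /existsPn eqIJ.
  by apply/eqP/setP => i; apply/eqP; move: (eqIJ i); rewrite negbK.
rewrite (bigD1 i) //= big_bool /G.
move: neqi; case: (i \in I); case: (i \in J) => // _;
  by rewrite /= !(expr0, expr1, mulr1, mul1r) addNr mul0r.
Qed.

Lemma chi_complete (R : realType) (n : nat) (x y : cube n) :
  \sum_(I : {set 'I_n}) chi R I x * chi R I y = (2 ^ n)%:R * (x == y)%:R.
Proof.
transitivity (\prod_(i < n) (coordinate R x i * coordinate R y i + 1)).
  rewrite bigA_distr; apply: eq_bigr => I _.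
  rewrite !chi_ifE -big_split; apply: eq_bigr => i _ /=.
  by case: (i \in I); rewrite ?mulr1.
rewrite /coordinate; have [<-|neqxy] := eqVneq x y.
  rewrite mulr1 -[n in (2 ^ n)%N]card_ord natrX -prodr_const.
  by apply: eq_bigr => i _; rewrite -expr2 sqrr_sign.
rewrite mulr0; have [i neqi] : exists i, x i != y i.
  apply/existsP; apply: contraNT neqxy => /existsPn eqxy.
  by apply/eqP/ffunP => i; apply/eqP; move: (eqxy i); rewrite negbK.
rewrite (bigD1 i) //=.
by move: neqi; case: (x i); case: (y i) => // _;
  rewrite /= !(expr0, expr1, mulr1, mul1r) addNr mul0r.
Qed.

Lemma fourier_expansion_exists (R : realType) (n : nat) (f : cube n -> R) :
  exists F fhat, fourier_expansion f F fhat.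
Proof.
have N0 : (2 ^ n)%:R != 0 :> R by rewrite pnatr_eq0 expn_eq0.
pose c I := (2 ^ n)%:R^-1 * \sum_(y : cube n) f y * chi R I y.
exists [set I | c I != 0], c; split=> [I|x]; first by rewrite inE.
transitivity (\sum_(I : {set 'I_n}) c I * chi R I x); last first.
  rewrite [RHS]big_mkcond; apply: eq_bigr => I _; rewrite inE.
  by case: eqP => [->|//]; rewrite mul0r.
transitivity ((2 ^ n)%:R^-1 *
    \sum_(y : cube n) f y * \sum_(I : {set 'I_n}) chi R I x * chi R I y).
  under eq_bigr do rewrite chi_complete.
  rewrite (bigD1 x) //= eqxx big1 => [|y /negPf yx].
    by rewrite addr0 mulr1 mulrCA mulVf ?mulr1.
  by rewrite eq_sym yx !mulr0.
under eq_bigr do rewrite mulr_sumr.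
rewrite exchange_big mulr_sumr; apply: eq_bigr => I _.
rewrite /c -mulrA mulr_suml; congr (_ * _); apply: eq_bigr => y _.
by rewrite -mulrA [chi R I x * _]mulrC.
Qed.

Lemma fourier_expansion_unique (R : realType) (n : nat) (f : cube n -> R)
    (F F' : {set {set 'I_n}}) (c c' : {set 'I_n} -> R) :
  fourier_expansion f F c -> fourier_expansion f F' c' ->
  F = F' /\ {in F, c =1 c'}.
Proof.
have N0 : (2 ^ n)%:R != 0 :> R by rewrite pnatr_eq0 expn_eq0.
have coefE G d J : fourier_expansion f G d ->
    \sum_(x : cube n) f x * chi R J x =
    (2 ^ n)%:R * (if J \in G then d J else 0).
  move=> [_ fE]; under eq_bigr do rewrite fE mulr_suml.
  rewrite exchange_big /=.
  under eq_bigr => I _ do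
    [under eq_bigr do rewrite -mulrA; rewrite -mulr_sumr chi_orthogonal].
  have [JG|JG] := ifPn.
    rewrite (bigD1 J) //= eqxx big1 ?addr0 ?mulr1; first exact: mulrC.
    by move=> I /andP[_ /negPf->]; rewrite !mulr0.
  rewrite mulr0 big1 // => I IG; have [IJ|_] := eqVneq I J.
    by rewrite -IJ IG in JG.
  by rewrite !mulr0.
move=> Fc Fc'; have eqc J :
    (if J \in F then c J else 0) = (if J \in F' then c' J else 0).
  by apply: (mulfI N0); rewrite -!coefE.
have eqF : F = F'.
  apply/setP => J; move: (eqc J) (Fc.1 J) (Fc'.1 J).
  case: (J \in F); case: (J \in F') => // e h h'.
    by move: (h isT); rewrite e eqxx.
  by move: (h' isT); rewrite -e eqxx.
by split=> // J JF; move: (eqc J); rewrite -eqF JF.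
Qed.

(* Main.v *)
Require Import Defs.
From mathcomp Require Import all_boot all_order all_algebra.
From mathcomp Require Import reals exp.
From mathcomp Require Import ring zify.

Set Implicit Arguments.
Unset Strict Implicit.
Unset Printing Implicit Defensive.

Import Order.TTheory GRing.Theory Num.Theory.

Local Open Scope ring_scope.

(** Replacing the coefficients of f by their absolute values a(I) only
    increases E f^(2r), because E (chi_(I_1) ... chi_(I_2r)) >= 0. Let g be the
    resulting function and A the sum of the a(I)^2. Expand E g^(2r) over tuples
    of sets. A contributing tuple other than (set0, ..., set0) has a nonempty
    member I with a(I) maximal; a chosen element of I belongs to an even number
    of members, hence to another member J, and a(J) <= a(I). Given I there are
    at most rho choices of J, and 2r (2r - 1) choices of the two positions. The
    other members contribute
      E (chi_I chi_J g^(2r-2)) <= E g^(2r-2),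
    since 2r - 2 is even. Therefore
      E g^(2r) <= a(set0)^(2r)
                  + 2r (2r - 1) rho (A - a(set0)^2) E g^(2r-2),
    and E g^2 = A gives E g^(2r) <= (2r)! rho^(r-1) A^r by induction. *)

(** * Power sums expanded over tuples *)

Lemma sum_ffun_prod (R : comNzRingType) (T : finType) M (h : T -> R) :
  (\sum_I h I) ^+ M = \sum_(t : {ffun 'I_M -> T}) \prod_k h (t k).
Proof.
by rewrite -(bigA_distr_bigA (fun _ => h)) prodr_const card_ord.
Qed.

(** For fixed [I] and [J], the indicator factors in [G] pin the entries at [p] and [q];
    distributivity then leaves a free sum at each of the other [M - 2] positions. *)
Lemma sum_ffun_prod2 (R : comNzRingType) (T : finType) M (h : T -> R)
    (w : T -> T -> R) (p q : 'I_M) : q != p ->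
  \sum_(t : {ffun 'I_M -> T}) w (t p) (t q) * \prod_k h (t k) =
  (\sum_I \sum_J w I J * (h I * h J)) * (\sum_I h I) ^+ M.-2.
Proof.
move=> qp.
pose G I J k K := if k == p then (K == I)%:R * h K
  else if k == q then (K == J)%:R * h K else h K.
have GE I J : \sum_(t : {ffun 'I_M -> T}) \prod_k G I J k (t k) =
    h I * h J * (\sum_I h I) ^+ M.-2.
  have delta K0 : \sum_K (K == K0)%:R * h K = h K0.
    rewrite (bigD1 K0) //= eqxx mul1r big1 ?addr0 // => K /negPf->.
    by rewrite mul0r.
  rewrite -(bigA_distr_bigA (G I J)) (bigD1 p) //= (bigD1 q) //=.
  rewrite /G eqxx (negPf qp) eqxx !delta mulrA; congr (_ * _).
  rewrite (eq_bigr (fun=> \sum_I h I)).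
    rewrite prodr_const; congr (_ ^+ _).
    have := cardC (pred2 p q); rewrite card_ord card2 eq_sym qp add2n.
    move=> /(congr1 (fun m => m.-2)) <- /=.
    by apply: eq_card => k; rewrite !inE negb_or.
  by move=> k /andP[/negPf-> /negPf->].
transitivity (\sum_(t : {ffun 'I_M -> T}) \sum_I \sum_J
    w I J * \prod_k G I J k (t k)); last first.
  rewrite exchange_big mulr_suml; apply: eq_bigr => I _.
  rewrite exchange_big mulr_suml; apply: eq_bigr => J _.
  by rewrite -mulr_sumr GE !mulrA.
apply: eq_bigr => t _.
have prod2 (H : 'I_M -> R) :
    \prod_k H k = H p * (H q * \prod_(k | (k != p) && (k != q)) H k).
  by rewrite (bigD1 p) //= (bigD1 q).
have Gprod I J : \prod_k G I J k (t k) =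
    (t p == I)%:R * (t q == J)%:R * \prod_k h (t k).
  rewrite !prod2.
  rewrite /G eqxx (negPf qp) eqxx (eq_bigr (fun k => h (t k))).
    by ring.
  by move=> k /andP[/negPf-> /negPf->].
rewrite (bigD1 (t p)) //= (bigD1 (t q)) //= Gprod !eqxx !mul1r.
rewrite [X in _ + X + _]big1 => [|J Jq]; last first.
  by rewrite Gprod [t q == J]eq_sym (negPf Jq) mulr0 mul0r mulr0.
rewrite [X in _ + X]big1 ?addr0 // => I Ip; apply: big1 => J _.
by rewrite Gprod [t p == I]eq_sym (negPf Ip) !mul0r mulr0.
Qed.

(** * Expectations, and moments of products of characters *)

Section Expectation.
Variables (R : realType) (n : nat).
Implicit Types (g h : cube n -> R).

Lemma eq_expectation g h : g =1 h -> expectation g = expectation h.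
Proof. by move=> gh; apply: eq_bigr => x _; rewrite gh. Qed.

Lemma expectationE g :
  expectation g = (2 ^ n)%:R^-1 * \sum_(x : cube n) g x.
Proof.
by rewrite /expectation -mulr_sumr prodr_const card_ord exprVn natrX.
Qed.

Lemma ler_expectation g h :
  (forall x, g x <= h x) -> expectation g <= expectation h.
Proof.
move=> gh; apply: ler_sum => x _; apply: ler_wpM2l => //.
by apply: prodr_ge0 => i _; rewrite invr_ge0.
Qed.

Lemma expectation_ge0 g : (forall x, 0 <= g x) -> 0 <= expectation g.
Proof.
move=> g0; apply: sumr_ge0 => x _; apply: mulr_ge0 => //.
by apply: prodr_ge0 => i _; rewrite invr_ge0.
Qed.

Lemma expectationZ (c : R) g :
  expectation (fun x => c * g x) = c * expectation g.
Proof. by rewrite !expectationE -mulr_sumr mulrCA. Qed.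

Lemma expectation_sum (T : finType) (P : pred T) (G : T -> cube n -> R) :
  expectation (fun x => \sum_(t | P t) G t x) =
  \sum_(t | P t) expectation (G t).
Proof.
rewrite expectationE exchange_big mulr_sumr.
by apply: eq_bigr => t _; rewrite expectationE.
Qed.

Lemma normr_chi (I : {set 'I_n}) (x : cube n) : `|chi R I x| = 1.
Proof.
rewrite /chi normr_prod big1 // => i _.
by rewrite /coordinate normrX normrN1 expr1n.
Qed.

Definition degree_at (M : nat) (t : {ffun 'I_M -> {set 'I_n}}) (i : 'I_n) :=
  (\sum_(k < M) (i \in t k))%N.

Definition chi_moment (M : nat) (t : {ffun 'I_M -> {set 'I_n}}) : R :=
  expectation (fun x => \prod_(k < M) chi R (t k) x).

(** By independence the expectation splits over the coordinates. Each factor is 2 or 0, so the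
    moment is 1 when every degree is even and 0 otherwise. *)
Lemma chi_momentE M (t : {ffun 'I_M -> {set 'I_n}}) :
  chi_moment t =
  (2 ^ n)%:R^-1 * \prod_(i < n) (1 + (-1) ^+ degree_at t i).
Proof.
rewrite /chi_moment expectationE; congr (_ * _).
pose G (i : 'I_n) (b : bool) : R := ((-1) ^+ b) ^+ degree_at t i.
transitivity (\sum_(x : cube n) \prod_(i < n) G i (x i)).
  apply: eq_bigr => x _; under eq_bigr do rewrite chi_ifE.
  rewrite exchange_big; apply: eq_bigr => i _.
  rewrite /G /degree_at -prodrXr; apply: eq_bigr => k _.
  by rewrite /coordinate; case: (i \in t k); rewrite ?expr1 ?expr0.
rewrite -(bigA_distr_bigA G); apply: eq_bigr => i _.
by rewrite big_bool /G expr0 expr1n expr1 addrC.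
Qed.

Lemma chi_moment_ge0 M (t : {ffun 'I_M -> {set 'I_n}}) : 0 <= chi_moment t.
Proof.
rewrite chi_momentE mulr_ge0 ?invr_ge0 //; apply: prodr_ge0 => i _.
by rewrite -signr_odd; case: odd; rewrite ?expr0 ?expr1 ?subrr ?addr_ge0.
Qed.

Lemma chi_moment_odd M (t : {ffun 'I_M -> {set 'I_n}}) i :
  odd (degree_at t i) -> chi_moment t = 0.
Proof.
move=> oddi; rewrite chi_momentE (bigD1 i) //= -signr_odd oddi expr1 subrr.
by rewrite mul0r mulr0.
Qed.

(** Summing over all sets, with coefficient zero off the family, lets the moment computations avoid
    any mention of [F]. *)
Definition fourier_sum (c : {set 'I_n} -> R) (x : cube n) : R :=
  \sum_I c I * chi R I x.

Lemma expectation_fourier_sumX (c : {set 'I_n} -> R) M :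
  expectation (fun x => fourier_sum c x ^+ M) =
  \sum_(t : {ffun 'I_M -> {set 'I_n}}) (\prod_k c (t k)) * chi_moment t.
Proof.
transitivity (expectation (fun x => \sum_(t : {ffun 'I_M -> {set 'I_n}})
    (\prod_k c (t k)) * \prod_k chi R (t k) x)).
  apply: eq_expectation => x; rewrite sum_ffun_prod.
  by apply: eq_bigr => t _; rewrite big_split.
by rewrite expectation_sum; apply: eq_bigr => t _; rewrite expectationZ.
Qed.

Lemma expectation_fourier_sum_sqr (c : {set 'I_n} -> R) :
  expectation (fun x => fourier_sum c x ^+ 2) = \sum_I c I ^+ 2.
Proof.
have N0 : (2 ^ n)%:R != 0 :> R by rewrite pnatr_eq0 expn_eq0.
transitivity (expectation (fun x : cube n => \sum_I \sum_J
    (c I * c J) * (chi R I x * chi R J x))).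
  apply: eq_expectation => x; rewrite expr2 mulr_suml.
  apply: eq_bigr => I _; rewrite mulr_sumr; apply: eq_bigr => J _.
  by rewrite mulrACA.
rewrite expectation_sum; apply: eq_bigr => I _.
rewrite expectation_sum (bigD1 I) //= big1 => [|J JI];
  rewrite expectationZ expectationE chi_orthogonal.
  by rewrite eqxx mulr1 mulVf // mulr1 addr0 expr2.
by rewrite eq_sym (negPf JI) !mulr0.
Qed.

Lemma fourier_sumX_le_norm (c : {set 'I_n} -> R) M :
  expectation (fun x => fourier_sum c x ^+ M) <=
  expectation (fun x => fourier_sum (fun I => `|c I|) x ^+ M).
Proof.
rewrite !expectation_fourier_sumX; apply: ler_sum => t _.
by rewrite ler_wpM2r ?chi_moment_ge0 // -normr_prod ler_norm.
Qed.

End Expectation.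

(** * Moment bounds for nonnegative coefficients *)

Section Moments.
Variables (R : realType) (n : nat) (a : {set 'I_n} -> R) (rho : nat).
Hypothesis a_ge0 : forall I, 0 <= a I.
Hypothesis a_width : forall i, (#|[set I | (a I != 0)%R && (i \in I)]| <= rho)%N.

(** Testing one element picked from [I], rather than whether [I] meets [J], is what lets the width
    bound the number of [J]. The value [false] at the empty set yields the term [- a set0 ^+ 2]
    below. *)
Definition dominates (I J : {set 'I_n}) : bool :=
  if [pick i in I] is Some i then (i \in J) && (a J <= a I) else false.

Lemma dominates0 J : dominates set0 J = false.
Proof. by rewrite /dominates; case: pickP => // i; rewrite inE. Qed.

Lemma sum_dominates :
  \sum_I \sum_J (dominates I J)%:R * (a I * a J) <=
  rho%:R * (\sum_I a I ^+ 2 - a set0 ^+ 2).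
Proof.
rewrite [X in _ <= _ * (X - _)](bigD1 set0) //= addrAC subrr add0r.
rewrite (bigD1 set0) //= big1 ?add0r => [|J _]; last first.
  by rewrite dominates0 mul0r.
rewrite mulr_sumr; apply: ler_sum => I _.
rewrite /dominates; case: pickP => [i _|_]; last first.
  by rewrite big1 => [|J _]; rewrite ?mul0r // mulr_ge0 ?sqr_ge0.
(* Only those [J] with nonzero coefficient that contain the picked [i] contribute, each at most
   [a I ^+ 2]; [a_width] bounds their number. *)
apply: (@le_trans _ _
    (\sum_(J in [set J | (a J != 0) && (i \in J)]) a I ^+ 2)).
  rewrite [leRHS]big_mkcond; apply: ler_sum => J _; rewrite inE.
  have [->|aJ] := eqVneq (a J) 0; first by rewrite !mulr0.
  case: (i \in J); rewrite /= ?mul0r //.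
  case: (leP (a J) (a I)) => aJI; rewrite ?mul0r ?sqr_ge0 //= mul1r expr2.
  by rewrite ler_wpM2l.
by rewrite sumr_const -[leLHS]mulr_natl ler_wpM2r ?sqr_ge0 // ler_nat.
Qed.

Lemma dominates_exists M (t : {ffun 'I_M -> {set 'I_n}}) :
  t != [ffun=> set0] -> chi_moment R t != 0 ->
  exists p q, q != p /\ dominates (t p) (t q).
Proof.
move=> tn0 mt0.
have /existsP[p0 tp0] : [exists p, t p != set0].
  apply: contraNT tn0 => /existsPn h; apply/eqP/ffunP => k; rewrite ffunE.
  by apply/eqP; rewrite -[_ == _]negbK.
case: (@Order.TotalTheory.arg_maxP _ R 'I_M p0 (fun p => t p != set0)
  (fun p => a (t p)) tp0) => p tpn0 pmax.
case: (set_0Vmem (t p)) => [tp|[j jp]]; first by rewrite tp eqxx in tpn0.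
have [i pick_i] : exists i, [pick i in t p] = Some i.
  by case: pickP => [i _|/(_ j)]; [exists i | rewrite jp].
have ip : i \in t p by move: pick_i; case: pickP => // k kp [<-].
have even_i : ~~ odd (degree_at t i).
  by apply: contra mt0 => /(chi_moment_odd R) ->.
have /existsP[q /andP[qp iq]] : [exists q, (q != p) && (i \in t q)].
  apply: contraNT even_i => /existsPn h.
  rewrite /degree_at (bigD1 p) //= ip big1 // => q qp.
  by move: (h q); rewrite qp /= => /negPf->.
exists p, q; split=> //; rewrite /dominates pick_i iq /=.
(* [t q] contains [i], so it is nonempty and the maximality of [a (t p)] applies to it. *)
by apply: pmax; apply/set0Pn; exists i.
Qed.

Let g := fourier_sum a.

Lemma dominated_tuples_le r (p q : 'I_(2 * r.+1)) : q != p ->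
  \sum_(t : {ffun 'I_(2 * r.+1) -> {set 'I_n}})
     (dominates (t p) (t q))%:R * ((\prod_k a (t k)) * chi_moment R t) <=
  rho%:R * (\sum_I a I ^+ 2 - a set0 ^+ 2) *
    expectation (fun x => g x ^+ (2 * r)).
Proof.
move=> qp.
have gX_ge0 x : 0 <= g x ^+ (2 * r) by rewrite exprM exprn_ge0 ?sqr_ge0.
(* Back under one expectation, the bound can be taken pointwise: [g x ^+ (2 * r)] is nonnegative and
   a product of two characters is at most 1. *)
have -> : \sum_(t : {ffun 'I_(2 * r.+1) -> {set 'I_n}})
     (dominates (t p) (t q))%:R * ((\prod_k a (t k)) * chi_moment R t) =
   expectation (fun x => (\sum_I \sum_J (dominates I J)%:R *
     ((a I * chi R I x) * (a J * chi R J x))) * g x ^+ (2 * r)).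
  transitivity (expectation (fun x : cube n =>
      \sum_(t : {ffun 'I_(2 * r.+1) -> {set 'I_n}})
        ((dominates (t p) (t q))%:R * \prod_k a (t k)) *
         \prod_k chi R (t k) x)).
    rewrite expectation_sum; apply: eq_bigr => t _.
    by rewrite expectationZ mulrA.
  apply: eq_expectation => x.
  have -> : (2 * r = (2 * r.+1).-2)%N by lia.
  rewrite /g /fourier_sum -(sum_ffun_prod2 (fun I => a I * chi R I x)
    (fun I J => (dominates I J)%:R) qp).
  by apply: eq_bigr => t _; rewrite big_split mulrA.
apply: le_trans (ler_wpM2r _ sum_dominates); last exact: expectation_ge0.
rewrite -expectationZ; apply: ler_expectation => x; apply: ler_wpM2r => //.
apply: ler_sum => I _; apply: ler_sum => J _; apply: ler_wpM2l => //.
rewrite mulrACA -[leRHS]mulr1; apply: ler_wpM2l; first exact: mulr_ge0.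
by apply: le_trans (ler_norm _) _; rewrite normrM !normr_chi mulr1.
Qed.

Lemma moment_recursion r :
  expectation (fun x => g x ^+ (2 * r.+1)) <=
  a set0 ^+ (2 * r.+1) +
  ((2 * r.+1) * (2 * r).+1)%:R * (rho%:R * (\sum_I a I ^+ 2 - a set0 ^+ 2) *
    expectation (fun x => g x ^+ (2 * r))).
Proof.
set B := rho%:R * _ * _.
pose M := (2 * r.+1)%N.
pose Y (t : {ffun 'I_M -> {set 'I_n}}) := (\prod_k a (t k)) * chi_moment R t.
have Y_ge0 t : 0 <= Y t by rewrite mulr_ge0 ?chi_moment_ge0 ?prodr_ge0.
have Y0 : Y [ffun=> set0] = a set0 ^+ M.
  rewrite /Y (eq_bigr (fun=> a set0)) => [|k _]; last by rewrite ffunE.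
  rewrite prodr_const card_ord /chi_moment expectationE.
  rewrite (eq_bigr (fun=> 1)) => [|x _]; last first.
    by rewrite big1 // => k _; rewrite ffunE /chi big_set0.
  rewrite sumr_const card_ffun card_bool card_ord mulVf ?mulr1 //.
  by rewrite pnatr_eq0 expn_eq0.
rewrite expectation_fourier_sumX -/M (bigD1 [ffun=> set0]) //= -/(Y _) Y0 lerD2l.
(* Every contributing tuple has at least one dominating pair of positions; counting it once per such
   pair only increases the sum, as [Y] is nonnegative. *)
apply: (@le_trans _ _ (\sum_(t : {ffun 'I_M -> {set 'I_n}})
   \sum_p \sum_(q | q != p) (dominates (t p) (t q))%:R * Y t)).
  rewrite big_mkcond; apply: ler_sum => t _ /=; case: ifP => tn0; last first.
    by apply: sumr_ge0 => p _; apply: sumr_ge0 => q _; rewrite mulr_ge0.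
  have [mt0|mt0] := eqVneq (chi_moment R t) 0.
    rewrite mt0 mulr0.
    by apply: sumr_ge0 => p _; apply: sumr_ge0 => q _; rewrite mulr_ge0.
  have [p [q [qp dpq]]] := dominates_exists tn0 mt0.
  rewrite -/(Y t) (bigD1 p) //= (bigD1 q) //= dpq mul1r -addrA lerDl addr_ge0 //.
    by apply: sumr_ge0 => q' _; rewrite mulr_ge0.
  by apply: sumr_ge0 => p' _; apply: sumr_ge0 => q' _; rewrite mulr_ge0.
rewrite exchange_big /=.
apply: (@le_trans _ _ (\sum_(p < M) \sum_(q < M | q != p) B)).
  apply: ler_sum => p _; rewrite exchange_big /=; apply: ler_sum => q qp.
  exact: dominated_tuples_le.
rewrite (eq_bigr (fun=> B *+ (2 * r).+1)) => [|p _]; last first.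
  rewrite sumr_const; congr (_ *+ _).
  by rewrite cardC1 card_ord /M; lia.
by rewrite sumr_const card_ord -mulrnA mulnC mulr_natl.
Qed.

(** Stated at [r.+1], so that the exponent [r - 1] of the theorem becomes [r] and the induction
    starts from the second moment. *)
Lemma moment_le r : (1 <= rho)%N ->
  expectation (fun x => g x ^+ (2 * r.+1)) <=
  (2 * r.+1)`!%:R * rho%:R ^+ r * (\sum_I a I ^+ 2) ^+ r.+1.
Proof.
move=> rho_gt0; set A := \sum_I a I ^+ 2.
have A_ge : a set0 ^+ 2 <= A.
  rewrite /A (bigD1 set0) //= lerDl; apply: sumr_ge0 => I _.
  exact: sqr_ge0.
have A_ge0 : 0 <= A by apply: le_trans A_ge; apply: sqr_ge0.
elim: r => [|r IHr].
  rewrite muln1 expectation_fourier_sum_sqr -/A mulr1 expr1 ler_peMl //.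
  by rewrite ler1n.
apply: le_trans (moment_recursion _) _; rewrite -/A.
set K := _`!%:R * rho%:R ^+ r.+1.
have K_ge1 : 1 <= K.
  by rewrite /K -natrX -natrM ler1n muln_gt0 fact_gt0 expn_gt0 rho_gt0.
(* This split of [A] matches the two terms of the recursion: [K >= 1] absorbs the power of [a set0],
   and the induction hypothesis handles the rest. *)
have -> : K * A ^+ r.+2 =
    K * (a set0 ^+ 2 * A ^+ r.+1) + K * ((A - a set0 ^+ 2) * A ^+ r.+1).
  by rewrite (exprS A r.+1); ring.
apply: lerD.
  rewrite exprM exprS; apply: (@le_trans _ _ (a set0 ^+ 2 * A ^+ r.+1)).
    by apply: ler_wpM2l; rewrite ?sqr_ge0 // lerXn2r // nnegrE ?sqr_ge0.
  by apply: ler_peMl => //; rewrite mulr_ge0 ?sqr_ge0 // exprn_ge0.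
(* The position count supplies the two new factors of the factorial, and the choice of [J] one new
   factor [rho]. *)
have -> : K * ((A - a set0 ^+ 2) * A ^+ r.+1) =
    ((2 * r.+2) * (2 * r.+1).+1)%:R * (rho%:R * (A - a set0 ^+ 2) *
      ((2 * r.+1)`!%:R * rho%:R ^+ r * A ^+ r.+1)).
  rewrite /K; have -> : (2 * r.+2 = (2 * r.+1).+2)%N by lia.
  by rewrite !factS !natrM (exprS rho%:R r); ring.
apply: ler_wpM2l => //; apply: ler_wpM2l => //.
by rewrite mulr_ge0 // subr_ge0.
Qed.

End Moments.

(** * From moments to norms *)

Theorem theorem2 (R : realType) (n : nat) (hn : (1 <= n)%N) (f : cube n -> R)
    (rho : nat) (hf : has_width f rho) (hrho : (1 <= rho)%N)
    (r : nat) (hr : (1 <= r)%N) :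
  Lp_norm (2 * r)%:R f <=
    ((2 * r)`!%:R * rho%:R ^+ (r - 1)) `^ ((2 * r)%:R^-1) * Lp_norm 2 f.
Proof.
case: hf => F [fhat [[_ fE] wF]].
pose c I := if I \in F then fhat I else 0.
have fc : f =1 fourier_sum c.
  move=> x; rewrite fE /fourier_sum [LHS]big_mkcond; apply: eq_bigr => I _.
  by rewrite /c; case: ifP => //; rewrite mul0r.
have normX k : expectation (fun x => `|f x| `^ (2 * k)%:R) =
    expectation (fun x => fourier_sum c x ^+ (2 * k)).
  apply: eq_expectation => x.
  by rewrite powR_mulrn // fc -normrX ger0_norm // exprM exprn_ge0 ?sqr_ge0.
(* The coefficients [c] vanish off [F], so taking absolute values keeps the width at most [rho]. *)
have width i : (#|[set I | (`|c I| != 0)%R && (i \in I)]| <= rho)%N.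
  rewrite -wF; apply: leq_trans (leq_bigmax i); apply: subset_leq_card.
  apply/subsetP => I; rewrite !inE /c; case: (I \in F) => /= [/andP[]//|].
  by rewrite normr0 eqxx.
case: r hr => // r _; rewrite subn1 /=.
set A := \sum_I c I ^+ 2.
have A_ge0 : 0 <= A by apply: sumr_ge0 => I _; apply: sqr_ge0.
set K := _`!%:R * _; have K_ge0 : 0 <= K by rewrite mulr_ge0 // exprn_ge0.
have le_moment :
    expectation (fun x => `|f x| `^ (2 * r.+1)%:R) <= K * A ^+ r.+1.
  rewrite normX; apply: le_trans (fourier_sumX_le_norm _ _) _.
  apply: le_trans (moment_le _ width r hrho) _ => //.
  rewrite (eq_bigr (fun I => c I ^+ 2)) // => I _.
  by rewrite real_normK ?num_real.
have -> : Lp_norm 2 f = A `^ 2^-1.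
  by have := normX 1%N; rewrite /Lp_norm muln1 expectation_fourier_sum_sqr => ->.
(* Written as a root of order [2 * r.+1], this factor merges with the constant, and monotonicity of
   that root reduces the goal to [le_moment]. *)
have -> : A `^ 2^-1 = (A ^+ r.+1) `^ (2 * r.+1)%:R^-1.
  rewrite -powR_mulrn // -powRrM natrM; congr (_ `^ _).
  by rewrite invfM mulrCA mulfV ?mulr1 ?pnatr_eq0.
rewrite -powRM ?exprn_ge0 //; apply: ge0_ler_powR => //.
- by rewrite invr_ge0.
- by rewrite nnegrE; apply: expectation_ge0 => x; apply: powR_ge0.
- by rewrite nnegrE mulr_ge0 ?exprn_ge0.
Qed.
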